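(* Let $M$ be an associate of $\beta$ or of $\beta^{2}$ in $\mathcal{O}$, with $M\ne\beta$ and $M\neq-\beta$. Then $x^{3}+y^{3}=M$ has no solutions with $x$ and $y$ in $\mathcal{K}$.
   Context: Let $u$ and $v$ be the two roots in $\mathbb{C}$ of $z^{2}+z+1=0$ (so $u,v$ are the primitive cube roots of unity), and $\beta=u-v$ (so $\beta^2=-3$). $\mathcal{O}$ is the set of $\mathbb{Z}$-linear combinations of $1,u,v$ (the ring of Eisenstein integers) and $\mathcal{K}$ is the set of $\mathbb{Q}$-linear combinations of $1,u,v$ (its field of fractions). Two elements of $\mathcal{O}$ are associates if each is the product of the other by a unit of $\mathcal{O}$; the units are $\pm1,\pm u,\pm v$. *)

(* Defs.v *)
From HB Require Import structures.
From mathcomp Require Import all_boot all_order all_algebra.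
From mathcomp Require Import reals.
From mathcomp Require Import complex.

Set Implicit Arguments.
Unset Strict Implicit.
Unset Printing Implicit Defensive.

Import Order.TTheory GRing.Theory Num.Theory.
Local Open Scope ring_scope.
Local Open Scope complex_scope.

(* For [R : realType], [R[i]] is the field of complex numbers.  The two roots
   [u], [v] of [z^2 + z + 1] are kept as parameters, so that neither of them
   is singled out. *)

Definition eisenstein_integer (R : realType) (u v z : R[i]) : Prop :=
  exists a b c : int, z = a%:~R + b%:~R * u + c%:~R * v.

Definition eisenstein_field (R : realType) (u v z : R[i]) : Prop :=
  exists a b c : rat, z = ratr a + ratr b * u + ratr c * v.

Definition eisenstein_unit (R : realType) (u v e : R[i]) : Prop :=
  eisenstein_integer u v e /\
  exists2 f : R[i], eisenstein_integer u v f & e * f = 1.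

Definition eisenstein_associates (R : realType) (u v x y : R[i]) : Prop :=
  [/\ eisenstein_integer u v x, eisenstein_integer u v y,
      exists2 e : R[i], eisenstein_unit u v e & x = y * e
    & exists2 e : R[i], eisenstein_unit u v e & y = x * e].

(* Main.v *)
Require Import Defs.
From HB Require Import structures.
From mathcomp Require Import all_boot all_order all_algebra.
From mathcomp Require Import ring zify.
From mathcomp Require Import reals.
From mathcomp Require Import complex.

(* Fermat-style descent in the Eisenstein integers.  Clearing denominators and
   common factors gives X^3 + Y^3 = e lam^(3n+k) Z^3 with X, Y coprime, e a
   unit, lam = u - v the prime above 3 not dividing Z, and k = 1 or 2.  Since
   cubes prime to lam are 1 or -1 modulo 9, n = 0 is impossible.  If n > 0,
   write X + Y = lam G; then G, om G - Y and om^2 G + Y sum to 0, are pairwise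
   coprime, and their product is e lam^(3(n-1)+k) Z^3.  Hence they are unit
   multiples of cubes, one of them times a power of lam, and modulo 9 either
   the sum relation has the original form with n - 1 in place of n, or k = 1
   and e = 1 or -1, that is, M = beta or - beta. *)

Set Implicit Arguments.
Unset Strict Implicit.
Unset Printing Implicit Defensive.

Import Order.TTheory GRing.Theory Num.Theory.
Local Open Scope ring_scope.
Local Open Scope complex_scope.

(** * Divisibility and coprimality in commutative rings *)

Section Comaximal.
Variable A : comNzRingType.
Implicit Types a b c d : A.

Definition divides d a := exists q, a = q * d.
Definition comaximal a b := exists s t, s * a + t * b = 1.

Lemma comaximal_sym a b : comaximal a b -> comaximal b a.
Proof. by case=> s [t e]; exists t, s; rewrite addrC. Qed.

Lemma comaximalMr a b c :
  comaximal a b -> comaximal a c -> comaximal a (b * c).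
Proof.
case=> s [t e] [s' [t' e']].
(* The product of the two relations, with the multiples of [a] collected. *)
exists (s * s' * a + s * t' * c + t * b * s'), (t * t').
by rewrite -[RHS]mulr1 -{1}e -e'; ring.
Qed.

Lemma comaximalXr a b n : comaximal a b -> comaximal a (b ^+ n).
Proof.
move=> h; elim: n => [|n IH]; first by exists 0, 1; rewrite expr0; ring.
by rewrite exprS; apply: comaximalMr.
Qed.

Lemma comaximal_dvdl a b d : divides d a -> comaximal a b -> comaximal d b.
Proof. by case=> q -> [s [t e]]; exists (s * q), t; rewrite -e; ring. Qed.

Lemma comaximal_gauss a b c :
  comaximal a b -> divides a (b * c) -> divides a c.
Proof.
case=> s [t e] [q h]; exists (s * c + t * q).
have -> : (s * c + t * q) * a = s * a * c + t * (q * a) by ring.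
by rewrite -h -[LHS]mul1r -e; ring.
Qed.

Lemma divides_mulr a b c : divides a b -> divides a (b * c).
Proof. by case=> q ->; exists (q * c); ring. Qed.

Lemma dividesD a b c : divides a b -> divides a c -> divides a (b + c).
Proof. by case=> q -> [p ->]; exists (q + p); ring. Qed.

End Comaximal.

(* With d = gcd(a, c) and a = a' d, both a' | d^2 and d^2 | a', so a is a unit
   times d^3: no factorization into primes is needed. *)
Lemma comaximal_cube (A : idomainType)
    (bezout : forall a b : A,
       exists g a' b', [/\ a = a' * g, b = b' * g & comaximal a' b'])
    (a b c : A) :
  comaximal a b -> a * b = c ^+ 3 ->
  exists e d, e \is a GRing.unit /\ a = e * d ^+ 3.
Proof.
move=> cab ec; have [d [a' [c' [ea ec' cac]]]] := bezout a c.
have [d0 | dN0] := eqVneq d 0.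
  by exists 1, 0; rewrite unitr1 expr0n /= mulr0 ea d0 mulr0.
(* Once [d] is cancelled, Gauss's lemma applies both ways: [a'] is coprime to [c'], and [d], a
   divisor of [a], is coprime to [b]. *)
have h : a' * b = c' ^+ 3 * d ^+ 2.
  apply: (mulIf dN0); move: ec; rewrite ea ec' => ec.
  by rewrite mulrAC ec; ring.
have [p hp] : divides a' (d ^+ 2).
  apply: (@comaximal_gauss _ _ (c' ^+ 3)); first exact: comaximalXr.
  by rewrite -h; exists b; rewrite mulrC.
have [q hq] : divides (d ^+ 2) a'.
  apply: (@comaximal_gauss _ _ b); last first.
    by exists (c' ^+ 3); rewrite mulrC.
  apply/comaximal_sym/comaximalXr/comaximal_sym/comaximal_dvdl/cab.
  by exists a'.
exists q, d; split; last by rewrite ea hq; ring.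
apply/unitrPr; exists p.
have d2 : d ^+ 2 != 0 by rewrite expf_neq0.
by apply: (mulIf d2); rewrite mul1r [RHS]hp [X in _ = p * X]hq; ring.
Qed.

(** * The ring of Eisenstein integers *)

(* [Eis a b] stands for a + b om, where om^2 = - 1 - om. *)
Record eis := Eis { eis1 : int; eisw : int }.

Definition pair_of_eis z := (eis1 z, eisw z).
Definition eis_of_pair p := Eis p.1 p.2.
Lemma pair_of_eisK : cancel pair_of_eis eis_of_pair.
Proof. by case. Qed.

HB.instance Definition _ := Choice.copy eis (can_type pair_of_eisK).

Definition eis_add x y := Eis (eis1 x + eis1 y) (eisw x + eisw y).
Definition eis_opp x := Eis (- eis1 x) (- eisw x).
Definition eis_mul x y :=
  Eis (eis1 x * eis1 y - eisw x * eisw y)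
      (eis1 x * eisw y + eisw x * eis1 y - eisw x * eisw y).

Lemma eis_addA : associative eis_add.
Proof. by move=> [a b] [c d] [e f]; congr Eis => /=; ring. Qed.
Lemma eis_addC : commutative eis_add.
Proof. by move=> [a b] [c d]; congr Eis => /=; ring. Qed.
Lemma eis_add0 : left_id (Eis 0 0) eis_add.
Proof. by move=> [a b]; congr Eis => /=; ring. Qed.
Lemma eis_addN : left_inverse (Eis 0 0) eis_opp eis_add.
Proof. by move=> [a b]; congr Eis => /=; ring. Qed.

HB.instance Definition _ :=
  GRing.isZmodule.Build eis eis_addA eis_addC eis_add0 eis_addN.

Lemma eis_mulA : associative eis_mul.
Proof. by move=> [a b] [c d] [e f]; congr Eis => /=; ring. Qed.
Lemma eis_mulC : commutative eis_mul.
Proof. by move=> [a b] [c d]; congr Eis => /=; ring. Qed.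
Lemma eis_mul1 : left_id (Eis 1 0) eis_mul.
Proof. by move=> [a b]; congr Eis => /=; ring. Qed.
Lemma eis_mulDl : left_distributive eis_mul +%R.
Proof. by move=> [a b] [c d] [e f]; congr Eis => /=; ring. Qed.
Lemma eis_1neq0 : Eis 1 0 != 0.
Proof. by []. Qed.

HB.instance Definition _ :=
  GRing.Zmodule_isComNzRing.Build eis eis_mulA eis_mulC eis_mul1 eis_mulDl
    eis_1neq0.

(** The squared modulus of a + b om; [conj] is complex conjugation, which sends om to om^2 = - 1 -
    om. *)
Definition norm x := eis1 x ^+ 2 - eis1 x * eisw x + eisw x ^+ 2.
Definition conj x := Eis (eis1 x - eisw x) (- eisw x).

Lemma normM x y : norm (x * y) = norm x * norm y.
Proof. by case: x y => [a b] [c d]; rewrite /norm /=; ring. Qed.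

Lemma normX x n : norm (x ^+ n) = norm x ^+ n.
Proof. by elim: n => [//|n IH]; rewrite !exprS normM IH. Qed.

Lemma norm_ge0 x : 0 <= norm x.
Proof. by case: x => [a b]; rewrite /norm /=; nia. Qed.

Lemma norm_eq0 x : (norm x == 0) = (x == 0).
Proof.
apply/eqP/eqP => [|-> //]; case: x => [a b]; rewrite /norm /= => h.
have -> : b = 0 by nia.
by have -> : a = 0 by nia.
Qed.

Lemma mul_conj x : x * conj x = Eis (norm x) 0.
Proof. by case: x => [a b]; congr Eis; rewrite /norm /=; ring. Qed.

Lemma norm_conj x : norm (conj x) = norm x.
Proof. by case: x => [a b]; rewrite /norm /=; ring. Qed.

Definition eis_unit := [pred x | norm x == 1].
Definition eis_inv x := if norm x == 1 then conj x else x.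

Lemma eis_mulV : {in eis_unit, left_inverse 1 eis_inv *%R}.
Proof.
by move=> x; rewrite inE /eis_inv mulrC => h; rewrite h mul_conj (eqP h).
Qed.

Lemma eis_unitP x y : y * x = 1 -> eis_unit x.
Proof.
move=> /(congr1 norm); rewrite normM [RHS]/norm /= => h.
apply/eqP; move: (norm_ge0 x) (norm_ge0 y) h.
move: (norm x) (norm y) => p q p0 q0 h.
have q1 : 1 <= q by nia.
have p1 : 1 <= p by nia.
by nia.
Qed.

Lemma eis_inv_out : {in [predC eis_unit], eis_inv =1 id}.
Proof. by move=> x; rewrite !inE /eis_inv => /negbTE ->. Qed.

HB.instance Definition _ :=
  GRing.ComNzRing_hasMulInverse.Build eis eis_mulV eis_unitP eis_inv_out.

Lemma eis_idomain : GRing.integral_domain_axiom eis.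
Proof.
move=> x y /(congr1 norm); rewrite normM => /eqP.
by rewrite [norm 0]/norm /= mulf_eq0 !norm_eq0.
Qed.

HB.instance Definition _ :=
  GRing.ComUnitRing_isIntegral.Build eis eis_idomain.

Lemma unit_norm (x : eis) : (x \is a GRing.unit) = (norm x == 1).
Proof. by []. Qed.

(** * Euclidean division and coprime factors of a cube *)

Lemma nearest_int (m n : int) : 0 < n -> exists q, `|2 * (m - q * n)| <= n.
Proof.
(* This is the floor of m/n + 1/2. *)
move=> n0; exists ((2 * m + n) %/ (2 * n))%Z.
have := divz_eq (2 * m + n) (2 * n).
have := modz_ge0 (2 * m + n) (_ : 2 * n != 0).
have := ltz_pmod (2 * m + n) (_ : 0 < 2 * n).
by set q := (_ %/ _)%Z; set r := (_ %% _)%Z; nia.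
Qed.

(** Round both coordinates of x/y = x conj(y) / norm(y). The errors are at most 1/2 in absolute
    value, so the norm of the error is at most 3/4. *)
Lemma eis_euclid (x y : eis) : y != 0 -> exists q, norm (x - q * y) < norm y.
Proof.
move=> y0; have n0 : 0 < norm y.
  by rewrite lt_def norm_ge0 norm_eq0 y0.
have [p hp] := nearest_int (eis1 (x * conj y)) n0.
have [q hq] := nearest_int (eisw (x * conj y)) n0.
(* Multiplying by [norm (conj y)] replaces x - q y by x conj(y) - q norm(y), which has the rounding
   errors as coordinates. *)
exists (Eis p q); rewrite -(ltr_pM2r n0).
rewrite -{1}(norm_conj y) -normM mulrBl -mulrA mul_conj.
move: hp hq; rewrite /norm -/(norm y) /=.
set n := norm y in n0 *; move: n n0 => n n0.
set a := eis1 x * _ - _; set b := eis1 x * _ + _ - _.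
have -> : a + - (p * n - q * 0) = a - p * n by ring.
have -> : b + - (p * 0 + q * n - q * 0) = b - q * n by ring.
move: (a - p * n) (b - q * n) => s t hs ht.
have s2 : 4 * (s * s) <= n * n by nia.
have t2 : 4 * (t * t) <= n * n by nia.
have st : - (4 * (s * t)) <= n * n by nia.
have n2 : 0 < n * n by rewrite mulr_gt0.
by rewrite !expr2; lia.
Qed.

(** Euclid's algorithm, by induction on the norm of [y]. Carrying comaximal cofactors along with the
    gcd also covers x = y = 0. *)
Lemma eis_bezout (x y : eis) :
  exists g a b, [/\ x = a * g, y = b * g & comaximal a b].
Proof.
have [n] := ubnP `|norm y|%N; elim: n x y => // n IH x y hn.
have [-> | y0] := eqVneq y 0.
  by exists x, 1, 0; split; [ring | ring | exists 1, 0; ring].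
have [q hq] := eis_euclid x y0.
have [|g [a [b [ey er [s [t e]]]]]] := IH y (x - q * y).
  by have := norm_ge0 (x - q * y); lia.
exists g, (q * a + b), a; split=> //.
  by rewrite mulrDl -er -mulrA -ey; ring.
by exists t, (s - t * q); rewrite -e; ring.
Qed.

Lemma comaximal_unitr (A : comUnitRingType) (a e : A) :
  e \is a GRing.unit -> comaximal a e.
Proof. by move=> he; exists 0, e^-1; rewrite mul0r add0r mulVr. Qed.

Lemma comaximal_unit_cube (a b c e : eis) :
  e \is a GRing.unit -> comaximal a b -> a * b = e * c ^+ 3 ->
  exists f d, f \is a GRing.unit /\ a = f * d ^+ 3.
Proof.
move=> he cab h.
apply: (@comaximal_cube _ eis_bezout a (b * e^-1) c).
  by apply: comaximalMr => //; apply: comaximal_unitr; rewrite unitrV.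
by rewrite mulrA h mulrAC mulrV // mul1r.
Qed.

(** * Units and the prime above 3 *)

Definition om := Eis 0 1.
Definition lam := Eis 1 2.

Lemma om2 : om ^+ 2 = - 1 - om. Proof. by []. Qed.
Lemma om3 : om ^+ 3 = 1. Proof. by []. Qed.
Lemma lam2 : lam ^+ 2 = - 3. Proof. by []. Qed.
Lemma unit_om n : om ^+ n \is a GRing.unit. Proof. by rewrite unitrX. Qed.
Lemma lam_neq0 n : lam ^+ n != 0. Proof. by rewrite expf_neq0. Qed.

(** Norm 1 bounds both coordinates by 1 in absolute value, which leaves six elements; for instance 1
    + om = - om^2. *)
Lemma unit_eisE (e : eis) : e \is a GRing.unit ->
  exists (s : bool) j, (j < 3)%N /\ e = (-1) ^+ s * om ^+ j.
Proof.
rewrite unit_norm => /eqP; case: e => [a b]; rewrite /norm !expr2 /= => h.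
have hb : b * b <= 1 by nia.
have ha : a * a <= 1 by nia.
have [] : a = 0 \/ a = 1 \/ a = -1 by nia.
  move=> ea; subst a; have [] : b = 1 \/ b = -1 by nia.
    by move=> ->; exists false, 1%N.
  by move=> ->; exists true, 1%N.
case=> ea; subst a.
  have [] : b = 0 \/ b = 1 by nia.
    by move=> ->; exists false, 0%N.
  by move=> ->; exists true, 2%N.
have [] : b = 0 \/ b = -1 by nia.
  by move=> ->; exists true, 0%N.
by move=> ->; exists false, 2%N.
Qed.

(** Modulo [lam], om is congruent to 1, so a + b om is congruent to a + b; and [lam] divides 3. *)
Lemma lam_divides a b k : a + b = 3 * k -> divides lam (Eis a b).
Proof.
move=> h; have -> : b = 3 * k - a by rewrite -h; ring.
by exists (Eis (2 * k - a) (k - a)); congr Eis => /=; ring.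
Qed.

(** The residue field at [lam] has three elements 0, 1, -1, read off from a + b modulo 3; remainder
    2 counts as -1. *)
Lemma lam_residue (x : eis) :
  divides lam x \/ exists (s : bool) t, x = (-1) ^+ s + t * lam.
Proof.
case: x => [a b]; have := divz_eq (a + b) 3.
have := modz_ge0 (a + b) (_ : 3 != 0 :> int).
have := ltz_pmod (a + b) (_ : 0 < 3 :> int).
set k := (_ %/ _)%Z; set r := (_ %% _)%Z => /(_ isT) r3 /(_ isT) r0 e.
have [er | [er | er]] : r = 0 \/ r = 1 \/ r = 2 by lia.
- by left; apply: (@lam_divides _ _ k); lia.
- have [|q hq] := @lam_divides (a - 1) b k; first lia.
  right; exists false, q; rewrite -hq.
  by congr Eis => /=; ring.
- have [|q hq] := @lam_divides (a + 1) b (k + 1); first lia.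
  right; exists true, q; rewrite -hq.
  by congr Eis => /=; ring.
Qed.

Lemma lam_prime (x y : eis) :
  divides lam (x * y) -> divides lam x \/ divides lam y.
Proof.
move=> h; have [|[s [t e]]] := lam_residue x; first by left.
right; apply: comaximal_gauss h.
(* An element congruent to a sign modulo [lam] is inverted by that sign, hence is comaximal with
   [lam]. *)
exists (- ((-1) ^+ s * t)), ((-1) ^+ s).
by rewrite e; case: s {e} => /=; ring.
Qed.

Lemma lam_primeX (x : eis) n : divides lam (x ^+ n) -> divides lam x.
Proof.
elim: n => [|n IH]; last by rewrite exprS => /lam_prime[].
by rewrite expr0 => h; rewrite -[x]mul1r; apply: divides_mulr.
Qed.

Lemma lam_unitN (e : eis) : e \is a GRing.unit -> ~ divides lam e.
Proof.
rewrite unit_norm => /eqP h [q /(congr1 norm)].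
by rewrite normM h [norm lam]/norm /=; lia.
Qed.

(** Write x = s + t lam with s a sign. As lam^2 = -3, the cube is s + 3 lam (t - t^3) - 9 s t^2, and
    [lam] divides t - t^3 by Fermat's little theorem in the field with three elements; finally 3
    lam^2 = -9. *)
Lemma cube_mod9 (x : eis) : ~ divides lam x ->
  exists (s : bool) t, x ^+ 3 = (-1) ^+ s + 9 * t.
Proof.
case: (lam_residue x) => // -[s [t ->]] _; exists s.
have [q hq] : divides lam (t - t ^+ 3).
  have -> : t - t ^+ 3 = t * (1 - t ^+ 2) by ring.
  have [h | [s' [t' ->]]] := lam_residue t; first exact: divides_mulr.
  rewrite mulrC; apply: divides_mulr.
  exists (- (2 * (-1) ^+ s' + t' * lam) * t').
  by case: s' => /=; ring.
exists (- ((-1) ^+ s * t ^+ 2) - q).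
have -> : ((-1) ^+ s + t * lam) ^+ 3 = (-1) ^+ s
   + 3 * lam * t + 3 * (-1) ^+ s * t ^+ 2 * lam ^+ 2 + t ^+ 3 * lam * lam ^+ 2.
  by case: s => /=; ring.
have -> : t ^+ 3 = t - q * lam by rewrite -hq; ring.
rewrite -[(t - _) * lam * _]mulrA -[lam * lam ^+ 2]exprS.
have -> : (t - q * lam) * lam ^+ 3 = t * lam * lam ^+ 2 - q * (lam ^+ 2) ^+ 2.
  by ring.
by rewrite lam2; ring.
Qed.

(** * Congruences modulo 9 *)

Definition mod9 (x : eis) := (9 %| eis1 x)%Z && (9 %| eisw x)%Z.

Lemma mod9P (x t : eis) : x = 9 * t -> mod9 x.
Proof.
case: t => [a b] ->; rewrite /mod9.
have -> : 9 * Eis a b = Eis (9 * a) (9 * b) by congr Eis => /=; ring.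
by rewrite !dvdz_mulr.
Qed.

(** By coprimality [lam] divides neither [X] nor [Y], so the left side is 0, 2 or -2 modulo 9, while
    the right side is om^j lam^k up to sign, with k = 1 or 2. *)
Lemma base_mod9 (k : nat) (X Y Z e : eis) :
  (k = 1 \/ k = 2)%N -> e \is a GRing.unit -> comaximal X Y ->
  ~ divides lam Z ->
  X ^+ 3 + Y ^+ 3 = e * lam ^+ k * Z ^+ 3 -> False.
Proof.
move=> hk he hXY hZ h.
have lamR : divides lam (X ^+ 3 + Y ^+ 3).
  rewrite h; apply: divides_mulr; rewrite mulrC; apply: divides_mulr.
  by case: hk => ->; [exists 1 | exists lam].
have ncop (x y : eis) : comaximal x y -> divides lam (x ^+ 3 + y ^+ 3) ->
    ~ divides lam x.
  move=> cxy hd hx; have hy : divides lam y.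
    apply: (@lam_primeX _ 3).
    have -> : y ^+ 3 = (x ^+ 3 + y ^+ 3) + x * (- x ^+ 2) by ring.
    by apply: dividesD => //; apply: divides_mulr.
  apply: (@lam_unitN 1); first exact: unitr1.
  by case: cxy => s [t <-]; apply: dividesD; rewrite mulrC; apply: divides_mulr.
have [s1 [t1 h1]] := cube_mod9 (ncop _ _ hXY lamR).
have [s2 [t2 h2]] : exists (s : bool) t, Y ^+ 3 = (-1) ^+ s + 9 * t.
  by apply/cube_mod9/(ncop _ X); [exact: comaximal_sym | rewrite addrC].
have [s3 [t3 h3]] := cube_mod9 hZ.
have [s [j [hj ee]]] := unit_eisE he.
have /mod9P : (-1) ^+ s1 + (-1) ^+ s2
   - (-1) ^+ s * om ^+ j * lam ^+ k * (-1) ^+ s3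
   = 9 * (e * lam ^+ k * t3 - t1 - t2).
  have -> : (-1) ^+ s1 + (-1) ^+ s2 = X ^+ 3 + Y ^+ 3 - 9 * (t1 + t2).
    by rewrite h1 h2; ring.
  by rewrite h h3 -ee; ring.
(* Only finitely many cases remain, each refuted by evaluating [mod9]. *)
move: hj; case: hk => ->; case: s1 {h1}; case: s2 {h2};
  case: s3 {h3}; case: s {ee};
  by case: j => [|[|[|]]].
Qed.

(** For m = 1 all cases are enumerated. For m > 1, 3 divides lam^m, hence also om^j2 + om^j3 up to
    signs; but if j2 and j3 differ, that sum has norm 1 or 3. *)
Lemma sum_mod9 (j1 j2 j3 m : nat) (s1 s2 s3 : bool) (t : eis) :
  (j1 < 3)%N -> (j2 < 3)%N -> (j3 < 3)%N -> (0 < m)%N ->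
  om ^+ j1 * lam ^+ m * (-1) ^+ s1 + om ^+ j2 * (-1) ^+ s2
    + om ^+ j3 * (-1) ^+ s3 = 9 * t ->
  j2 = j3 \/ m = 1%N /\ om ^+ (j1 + j2 + j3) = 1.
Proof.
move=> l1 l2 l3 m0 h.
have [m1 | m2] : m = 1%N \/ (1 < m)%N by lia.
  subst m; move: h => /mod9P; move: l1 l2 l3.
  case: j1 => [|[|[|//]]] _; case: j2 => [|[|[|//]]] _;
  case: j3 => [|[|[|//]]] _;
  case: s1; case: s2; case: s3 => h;
  first [by left | by right | by move: h; vm_compute].
left; have e : om ^+ j2 * (-1) ^+ s2 + om ^+ j3 * (-1) ^+ s3
    = 3 * (3 * t + om ^+ j1 * lam ^+ (m - 2) * (-1) ^+ s1).
  have em : lam ^+ m = lam ^+ (m - 2) * (- 3) by rewrite -lam2 -exprD subnK.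
  rewrite mulrDr mulrA -[3 * 3]/(9 : eis) -h em; ring.
(* The factor 3 lets the test modulo 9 decide divisibility by 3. *)
have /mod9P : 3 * (om ^+ j2 * (-1) ^+ s2 + om ^+ j3 * (-1) ^+ s3)
   = 9 * (3 * t + om ^+ j1 * lam ^+ (m - 2) * (-1) ^+ s1) by rewrite e; ring.
move: l2 l3.
case: j2 {h e} => [|[|[|//]]] _; case: j3 => [|[|[|//]]] _;
  by case: s2; case: s3.
Qed.

Lemma unit_mod9 (j1 j2 : nat) (s1 s2 : bool) (t : eis) :
  om ^+ j1 * (-1) ^+ s1 - om ^+ j2 * (-1) ^+ s2 = 9 * t ->
  om ^+ j1 = om ^+ j2.
Proof.
have red i : om ^+ i = om ^+ (i %% 3).
  by rewrite {1}(divn_eq i 3) exprD mulnC exprM om3 expr1n mul1r.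
rewrite [om ^+ j1]red [om ^+ j2]red.
have := @ltn_pmod j2 3 isT; have := @ltn_pmod j1 3 isT.
move: (j1 %% 3)%N (j2 %% 3)%N => i1 i2 + + /mod9P.
case: i1 => [|[|[|//]]] _; case: i2 => [|[|[|//]]] _;
  by case: s1; case: s2.
Qed.

(** * The descent *)

(* The unit can be taken without sign, since the sign is itself a cube. *)
Lemma comaximal_om_cube (a b c e : eis) :
  e \is a GRing.unit -> comaximal a b -> a * b = e * c ^+ 3 ->
  exists j d, (j < 3)%N /\ a = om ^+ j * d ^+ 3.
Proof.
move=> he cab h.
have [f [d [/unit_eisE [s [j [hj ->]]] ->]]] := comaximal_unit_cube he cab h.
exists j, ((-1) ^+ s * d); split=> //.
by case: s => /=; ring.
Qed.

(* For [k = 1] the values [e = 1, -1], i.e. [M = beta, - beta], are excluded. *)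
Definition admissible (k : nat) (e : eis) :=
  [/\ k = 1%N \/ k = 2%N, e \is a GRing.unit
    & k = 1%N -> e <> 1 /\ e <> -1].

(** [H1] is whichever of the three factors [lam] divides; by coprimality it absorbs the whole power
    of [lam]. *)
Lemma descent_step (n k : nat) (H1 H2 H3 Z e : eis) :
  admissible k e -> ~ divides lam Z -> divides lam H1 ->
  comaximal H1 H2 -> comaximal H1 H3 -> comaximal H2 H3 ->
  H1 + H2 + H3 = 0 -> H1 * H2 * H3 = e * lam ^+ (3 * n + k) * Z ^+ 3 ->
  exists b c a e', [/\ admissible k e', comaximal b c, ~ divides lam a
    & b ^+ 3 + c ^+ 3 = e' * lam ^+ (3 * n + k) * a ^+ 3].
Proof.
move=> [hk he hke] hZ hl c12 c13 c23 hs hp.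
set m := (3 * n + k)%N in hp *.
have m0 : (0 < m)%N by rewrite /m; case: hk => ->; lia.
have clam x : comaximal H1 x -> comaximal (lam ^+ m) x.
  move=> cx; apply/comaximal_sym/comaximalXr/comaximal_sym.
  exact: comaximal_dvdl cx.
have [K1 eK] : divides (lam ^+ m) H1.
  apply: (@comaximal_gauss _ _ (H2 * H3)).
    by apply: comaximalMr; apply: clam.
  exists (e * Z ^+ 3); rewrite mulrC mulrA hp; ring.
have dK : divides K1 H1 by exists (lam ^+ m); rewrite eK mulrC.
have hK : K1 * H2 * H3 = e * Z ^+ 3.
  apply: (mulIf (lam_neq0 m)).
  have -> : K1 * H2 * H3 * lam ^+ m = H1 * H2 * H3 by rewrite eK; ring.
  by rewrite hp; ring.
have k12 := comaximal_dvdl dK c12; have k13 := comaximal_dvdl dK c13.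
have [j1 [a [hj1 ea]]] : exists j d, (j < 3)%N /\ K1 = om ^+ j * d ^+ 3.
  apply: (@comaximal_om_cube K1 (H2 * H3) Z e) => //.
    exact: comaximalMr.
  by rewrite mulrA.
have [j2 [b [hj2 eb]]] : exists j d, (j < 3)%N /\ H2 = om ^+ j * d ^+ 3.
  apply: (@comaximal_om_cube H2 (K1 * H3) Z e) => //.
    by apply: comaximalMr => //; apply: comaximal_sym.
  by rewrite -hK; ring.
have [j3 [c [hj3 ec]]] : exists j d, (j < 3)%N /\ H3 = om ^+ j * d ^+ 3.
  apply: (@comaximal_om_cube H3 (K1 * H2) Z e) => //.
    by apply: comaximalMr; apply: comaximal_sym.
  by rewrite -hK; ring.
have hJ : om ^+ (j1 + j2 + j3) * (a * b * c) ^+ 3 = e * Z ^+ 3.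
  by rewrite -hK ea eb ec !exprD; ring.
have habc : ~ divides lam (a * b * c).
  move=> h; have : divides lam (e * Z ^+ 3).
    by rewrite -hJ mulrC [(a * b * c) ^+ 3]exprS; do 2![apply: divides_mulr].
  by case/lam_prime => [hle | /lam_primeX]; first exact: (lam_unitN he).
have ha : ~ divides lam a.
  by move=> h; apply: habc; do 2![apply: divides_mulr].
have hb : ~ divides lam b.
  move=> h; apply: habc; apply: divides_mulr.
  by rewrite mulrC; apply: divides_mulr.
have hc : ~ divides lam c.
  by move=> h; apply: habc; rewrite mulrC; apply: divides_mulr.
have [s [j [hj ee]]] := unit_eisE he.
(* Both sides of [hJ] are compared modulo 9, where the cubes become signs. *)
have eJ : e = (-1) ^+ s * om ^+ (j1 + j2 + j3).
  have [s1 [t1 h1]] := cube_mod9 habc; have [s2 [t2 h2]] := cube_mod9 hZ.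
  rewrite (@unit_mod9 (j1 + j2 + j3) j s1 (s (+) s2)
      (e * t2 - om ^+ (j1 + j2 + j3) * t1)) //.
  have -> : om ^+ (j1 + j2 + j3) * (-1) ^+ s1 =
     om ^+ (j1 + j2 + j3) * (a * b * c) ^+ 3 - 9 * om ^+ (j1 + j2 + j3) * t1.
    by rewrite h1; ring.
  by rewrite hJ h2 ee signr_addb; ring.
have hsum : om ^+ j1 * lam ^+ m * a ^+ 3 + om ^+ j2 * b ^+ 3
    + om ^+ j3 * c ^+ 3 = 0.
  by rewrite -hs eK ea eb ec; ring.
have [e23 | [m1 J1]] : j2 = j3 \/ m = 1%N /\ om ^+ (j1 + j2 + j3) = 1.
  have [s1 [t1 h1]] := cube_mod9 ha; have [s2 [t2 h2]] := cube_mod9 hb.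
  have [s3 [t3 h3]] := cube_mod9 hc.
  apply: (@sum_mod9 j1 j2 j3 m s1 s2 s3
    (- (om ^+ j1 * lam ^+ m * t1 + om ^+ j2 * t2 + om ^+ j3 * t3))) => //.
  by apply/eqP; rewrite -subr_eq0 -hsum h1 h2 h3; apply/eqP; ring.
(* Dividing the sum relation by om^j2 gives the unit - om^(j1 - j2). Since j2 = j3 and om^3 = 1,
   this is - om^(j1 + j2 + j3), which is [e] up to sign, so admissibility is inherited. *)
- exists b, c, a, (- om ^+ (j1 + j2 + j3)); split=> //.
  + split=> //; first by rewrite unitrN unit_om.
    move=> /hke; rewrite eJ; case: (s) => /=.
      by rewrite expr1 mulN1r.
    rewrite expr0 mul1r => -[e1 e2]; split=> he'; [apply: e2 | apply: e1];
      by apply: oppr_inj; rewrite he' ?opprK.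
  + apply: comaximal_dvdl (comaximal_sym (comaximal_dvdl _ (comaximal_sym c23))).
      by exists (om ^+ j2 * b ^+ 2); rewrite eb; ring.
    by exists (om ^+ j3 * c ^+ 2); rewrite ec; ring.
  + subst j3.
    have e0 : om ^+ (2 * j2) * om ^+ j2 = 1.
      by rewrite -exprD addnC -mulSn exprM om3 expr1n.
    have -> : b ^+ 3 + c ^+ 3 = om ^+ (2 * j2) * om ^+ j2 * (b ^+ 3 + c ^+ 3).
      by rewrite e0 mul1r.
    have -> : om ^+ (2 * j2) * om ^+ j2 * (b ^+ 3 + c ^+ 3) = om ^+ (2 * j2) *
       (om ^+ j1 * lam ^+ m * a ^+ 3 + om ^+ j2 * b ^+ 3 + om ^+ j2 * c ^+ 3)
       - om ^+ (2 * j2) * om ^+ j1 * lam ^+ m * a ^+ 3 by ring.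
    by rewrite hsum -addnA addnn -mul2n exprD; ring.
(* Here m = 1 forces n = 0 and k = 1, and [e] is a sign, which [admissible] excludes. *)
- exfalso; have k1 : k = 1%N by rewrite /m in m1; case: hk => hk; lia.
  have [e1 e2] := hke k1; rewrite J1 mulr1 in eJ.
  by case: (s) eJ.
Qed.

Lemma no_solution_normalized (n k : nat) (X Y Z e : eis) :
  admissible k e -> comaximal X Y -> ~ divides lam Z ->
  X ^+ 3 + Y ^+ 3 = e * lam ^+ (3 * n + k) * Z ^+ 3 -> False.
Proof.
elim: n X Y Z e => [|n IH] X Y Z e ad cXY hZ h.
  by case: ad => hk he _; apply: (base_mod9 hk he cXY hZ h).
(* Cubing is additive modulo 3 = - lam^2. *)
have [G eG] : divides lam (X + Y).
  apply: (@lam_primeX _ 3).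
  have -> : (X + Y) ^+ 3 = X ^+ 3 + Y ^+ 3 + lam ^+ 2 * - (X * Y * (X + Y)).
    by rewrite lam2; ring.
  apply: dividesD; last by apply: divides_mulr; exists lam.
  rewrite h mulrAC mulrC; apply: divides_mulr.
  by exists (lam ^+ (3 * n + 2 + k)); rewrite -exprSr; congr (_ ^+ _); lia.
have eX : X = lam * G - Y by rewrite mulrC -eG addrK.
have [s [t est]] : comaximal G Y.
  by case: cXY => s [t est]; exists (s * lam), (t - s); rewrite -est eX; ring.
(* These are om (X + om Y) / lam and om^2 (X + om^2 Y) / lam: the other two linear factors of X^3 +
   Y^3, with units chosen to make the three sum to 0. *)
pose H2 := om * G - Y; pose H3 := om ^+ 2 * G + Y.
have c12 : comaximal G H2.
  by exists (s + t * om), (- t); rewrite -est /H2; ring.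
have c13 : comaximal G H3.
  by exists (s - t * om ^+ 2), t; rewrite -est /H3; ring.
have hs : G + H2 + H3 = 0.
  have -> : G + H2 + H3 = (1 + om + om ^+ 2) * G by rewrite /H2 /H3; ring.
  by rewrite om2; ring.
have eH3 : H3 = - G - H2.
  by apply/eqP; rewrite -subr_eq0 -hs; apply/eqP; ring.
have c23 : comaximal H2 H3.
  by case: c12 => p [q epq]; exists (q - p), (- p); rewrite -epq eH3; ring.
have hp : G * H2 * H3 = e * lam ^+ (3 * n + k) * Z ^+ 3.
  apply: (mulIf (lam_neq0 3)).
  have -> : e * lam ^+ (3 * n + k) * Z ^+ 3 * lam ^+ 3 = X ^+ 3 + Y ^+ 3.
    have -> : e * lam ^+ (3 * n + k) * Z ^+ 3 * lam ^+ 3 =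
      e * (lam ^+ (3 * n + k) * lam ^+ 3) * Z ^+ 3 by ring.
    by rewrite -exprD h; congr (_ * _ ^+ _ * _); lia.
  have -> : X ^+ 3 + Y ^+ 3 =
      lam ^+ 3 * G ^+ 3 - 3 * lam ^+ 2 * G ^+ 2 * Y + 3 * lam * G * Y ^+ 2.
    by rewrite eX; ring.
  have -> : G * H2 * H3 =
      om ^+ 3 * G ^+ 3 + (om - om ^+ 2) * G ^+ 2 * Y - G * Y ^+ 2.
    by rewrite /H2 /H3; ring.
  rewrite om3 -[om - _]/lam; have -> : 3 = - lam ^+ 2 by [].
  ring.
have descend A B C : divides lam A -> comaximal A B -> comaximal A C ->
    comaximal B C -> A + B + C = 0 ->
    A * B * C = e * lam ^+ (3 * n + k) * Z ^+ 3 -> False.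
  move=> hA cAB cAC cBC hs' hp'.
  have [b [c [a [e' [ad' cbc ha h']]]]] :=
    descent_step ad hZ hA cAB cAC cBC hs' hp'.
  exact: IH ad' cbc ha h'.
have : divides lam (G * H2 * H3).
  rewrite hp mulrAC; rewrite mulrC; apply: divides_mulr.
  exists (lam ^+ (3 * n + k).-1); rewrite -exprSr prednK //.
  by case: ad => -[] -> _ _; lia.
case/lam_prime => [/lam_prime [h1 | h2] | h3].
- exact: descend h1 c12 c13 c23 hs hp.
- apply: descend h2 (comaximal_sym c12) c23 c13 _ _; first by rewrite -hs; ring.
  by rewrite -hp; ring.
- apply: descend h3 (comaximal_sym c13) (comaximal_sym c23) c12 _ _.
    by rewrite -hs; ring.
  by rewrite -hp; ring.
Qed.

(** * Reduction to coprime [X] and [Y] *)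

Lemma lam_split (z : eis) : z != 0 ->
  exists n y, z = lam ^+ n * y /\ ~ divides lam y.
Proof.
have [n] := ubnP `|norm z|%N; elim: n z => // n IH z hn z0.
have [[q eq] | [s [t et]]] := lam_residue z; last first.
  exists 0%N, z; split; first by rewrite mul1r.
  move=> [q eq]; apply: (@lam_unitN ((-1) ^+ s)).
    by rewrite unitrX // unitrN unitr1.
  exists (q - t); rewrite mulrBl -eq et; ring.
have q0 : q != 0 by apply: contraNneq z0 => q0; rewrite eq q0 mul0r.
have [|i [y [ey hy]]] := IH q _ q0.
  have : 0 < norm q by rewrite lt_def norm_ge0 norm_eq0 q0.
  move: hn; rewrite eq normM -[norm lam]/(3 : int); lia.
by exists i.+1, y; split=> //; rewrite eq ey exprS; ring.
Qed.

(** After division by common factors, what is left of gcd(X, Y) is [g'], coprime to [z]. Its cube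
    divides e lam^k, whose norm is 3 or 9; so [g'] is a unit and can be moved into [z], from which
    the powers of [lam] are then extracted. *)
Lemma no_solution (k : nat) (X Y Z e : eis) :
  admissible k e -> Z != 0 ->
  X ^+ 3 + Y ^+ 3 = e * lam ^+ k * Z ^+ 3 -> False.
Proof.
move=> ad Z0 h; have [g [x [y [ex ey cxy]]]] := eis_bezout X Y.
have [d [g' [z [eg ez cgz]]]] := eis_bezout g Z.
have d0 : d != 0 by apply: contraNneq Z0 => d0; rewrite ez d0 mulr0.
have h' : g' ^+ 3 * (x ^+ 3 + y ^+ 3) = e * lam ^+ k * z ^+ 3.
  have d3 : d ^+ 3 != 0 by rewrite expf_neq0.
  apply: (mulIf d3).
  have -> : e * lam ^+ k * z ^+ 3 * d ^+ 3 = X ^+ 3 + Y ^+ 3.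
    by rewrite h ez; ring.
  by rewrite ex ey eg; ring.
have ug : g' \is a GRing.unit.
  have [q] : divides (g' ^+ 3) (e * lam ^+ k).
    apply: (@comaximal_gauss _ _ (z ^+ 3)); last first.
      by exists (x ^+ 3 + y ^+ 3); rewrite mulrC -h' mulrC.
    by apply: comaximalXr; apply/comaximal_sym/comaximalXr/comaximal_sym.
  move=> /(congr1 norm); rewrite [g' ^+ 3]exprS expr2 !normM normX.
  case: ad => hk; rewrite !unit_norm => /eqP -> _.
  rewrite mul1r -[norm lam]/(3 : int).
  move: (norm_ge0 g') (norm_ge0 q); move: (norm g') (norm q) => u v u0 v0 hu.
  have u1 : u != 0.
    by apply/eqP => u1; move: hu; rewrite u1 !mul0r mulr0; case: hk => ->.
  have [// | u2] : u = 1 \/ 2 <= u by lia.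
    by move=> ->.
  have [// | u3] : u = 2 \/ 3 <= u by lia.
    by move=> u2'; subst u; case: hk hu => ->; rewrite ?expr1 ?expr2; lia.
  have v1 : 1 <= v by case: hk hu => ->; rewrite ?expr1 ?expr2; nia.
  (* The cube of a norm at least 3 already exceeds 9. *)
  have : 27 <= v * (u * (u * u)) by nia.
  by rewrite -hu; case: hk => ->.
have z0 : z != 0 by apply: contraNneq Z0 => z0; rewrite ez z0 mul0r.
have zg : z / g' != 0.
  rewrite mulf_neq0 // invr_neq0 //.
  by apply: contraTneq ug => ->; rewrite unitr0.
have [n [w [ew hw]]] := lam_split zg.
apply: (@no_solution_normalized n k x y w e) => //.
have -> : e * lam ^+ (3 * n + k) * w ^+ 3 = e * lam ^+ k * (lam ^+ n * w) ^+ 3.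
  by rewrite exprD mulnC exprM; ring.
rewrite -ew exprMn mulrA -h' mulrC mulrA -exprMn mulVr // expr1n mul1r //.
Qed.

(** * Transfer to the complex numbers *)

Section Embedding.
Variables (F : numFieldType) (u : F).
Hypothesis hu : u ^+ 2 + u + 1 = 0.

Definition eis_embed (z : eis) : F := (eis1 z)%:~R + (eisw z)%:~R * u.

Lemma eis_embedD : {morph eis_embed : x y / x + y}.
Proof. by move=> x y; rewrite /eis_embed /= !intrD; ring. Qed.

Lemma eis_embedM : {morph eis_embed : x y / x * y}.
Proof.
move=> x y; rewrite /eis_embed /= !intrB !intrD !intrM.
apply/eqP; rewrite -subr_eq0; apply/eqP.
(* The two sides differ by a multiple of u^2 + u + 1. *)
rewrite -[RHS](mulr0 (- ((eisw x)%:~R * (eisw y)%:~R))) -hu; ring.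
Qed.

Lemma eis_embed1 : eis_embed 1 = 1.
Proof. by rewrite /eis_embed /= mul0r addr0. Qed.

Lemma eis_embedX x n : eis_embed (x ^+ n) = eis_embed x ^+ n.
Proof.
by elim: n => [|n IH]; rewrite ?eis_embed1 // !exprS eis_embedM IH.
Qed.

Lemma eis_embed_int (d : int) : eis_embed (Eis d 0) = d%:~R.
Proof. by rewrite /eis_embed /= mul0r addr0. Qed.

(** Multiplying by the conjugate turns [x] into its integer norm, which stays nonzero in
    characteristic 0. *)
Lemma eis_embed_eq0 x : eis_embed x = 0 -> x = 0.
Proof.
move=> h; have := eis_embedM x (conj x).
rewrite h mul0r mul_conj eis_embed_int => /eqP.
by rewrite intr_eq0 norm_eq0 => /eqP.
Qed.

Lemma eis_embed_inj : injective eis_embed.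
Proof.
move=> x y h; apply/eqP; rewrite -subr_eq0; apply/eqP/eis_embed_eq0.
have := eis_embedD (x - y) y; rewrite subrK h.
by move=> /eqP; rewrite eq_sym -subr_eq0 addrK => /eqP.
Qed.

End Embedding.

Section Eisenstein.
Variables (R : realType) (u v : R[i]).
Hypotheses (hu : u ^+ 2 + u + 1 = 0) (huv : v = - 1 - u).

Lemma eisenstein_integerP z : eisenstein_integer u v z ->
  exists t, z = eis_embed u t.
Proof.
case=> a [b [c ->]]; exists (Eis (a - c) (b - c)).
by rewrite huv /eis_embed /= !intrB; ring.
Qed.

Lemma eisenstein_unitP z : eisenstein_unit u v z ->
  exists2 e : eis, e \is a GRing.unit & z = eis_embed u e.
Proof.
case=> /eisenstein_integerP [e ->] [f /eisenstein_integerP [g ->]] h.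
exists e => //; apply/unitrPr; exists g.
by apply: (eis_embed_inj hu); rewrite eis_embedM // eis_embed1.
Qed.

Lemma eisenstein_fieldP z : eisenstein_field u v z ->
  exists t (d : int), d != 0 /\ z * d%:~R = eis_embed u t.
Proof.
case=> a [b [c ez]]; pose p := a - c; pose q := b - c.
exists (Eis (numq p * denq q) (numq q * denq p)), (denq p * denq q).
split; first by rewrite mulf_neq0 // denq_neq0.
have -> : z = ratr p + ratr q * u.
  by rewrite ez huv /p /q !rmorphB /=; ring.
rewrite /eis_embed /ratr /= !intrM.
have hp : (denq p)%:~R != 0 :> R[i] by rewrite intr_eq0 denq_neq0.
have hq : (denq q)%:~R != 0 :> R[i] by rewrite intr_eq0 denq_neq0.
by field; rewrite hp hq.
Qed.

End Eisenstein.

Theorem theorem1p7 (R : realType) (u v beta M : R[i])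
    (hu : u ^+ 2 + u + 1 = 0) (hv : v ^+ 2 + v + 1 = 0) (huv : u <> v)
    (hbeta : beta = u - v)
    (hM : eisenstein_associates u v M beta \/
          eisenstein_associates u v M (beta ^+ 2))
    (hM1 : M <> beta) (hM2 : M <> - beta) :
  ~ exists x y : R[i],
      [/\ eisenstein_field u v x, eisenstein_field u v y
        & x ^+ 3 + y ^+ 3 = M].
Proof.
have ev : v = - 1 - u.
  have /eqP : (u - v) * (u + v + 1) = 0.
    have -> : (u - v) * (u + v + 1) = (u ^+ 2 + u + 1) - (v ^+ 2 + v + 1).
      by ring.
    by rewrite hu hv subrr.
  rewrite mulf_eq0 subr_eq0 => /orP [/eqP // | /eqP h].
  by rewrite -[RHS]addr0 -h; ring.
have eb : beta = eis_embed u lam by rewrite hbeta ev /eis_embed /=; ring.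
(* The exponent [k] is that of [beta]; for k = 1 the units 1 and -1 would give [beta] and
   [- beta]. *)
have [k [e [ad eM]]] : exists k e,
    admissible k e /\ M = eis_embed u e * eis_embed u lam ^+ k.
  case: hM => -[_ _ [z /(eisenstein_unitP hu ev) [e he ->] eM] _].
    exists 1%N, e; rewrite expr1 mulrC -eb; split=> //; split=> //; first by left.
    move=> _; split=> e1.
      by apply: hM1; rewrite eM e1 eis_embed1 mulr1.
    by apply: hM2; rewrite eM e1 (eis_embed_int u (- 1)) mulrN1.
  by exists 2%N, e; rewrite mulrC -eb; split=> //; split=> //; right.
case=> x [y [/(eisenstein_fieldP ev) [X [a [a0 eX]]]
             /(eisenstein_fieldP ev) [Y [b [b0 eY]]] h]].
(* With x = X/a and y = Y/b, multiply the equation by (a b)^3. *)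
apply: (@no_solution k (X * Eis b 0) (Y * Eis a 0) (Eis (a * b) 0) e) => //.
  by rewrite -norm_eq0 /norm /= mulr0 subr0 addr0 expf_neq0 // mulf_neq0.
apply: (eis_embed_inj hu).
rewrite eis_embedD ?(eis_embedM hu, eis_embedX hu) !eis_embed_int -eX -eY -eM.
by rewrite -h intrM; ring.
Qed.
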